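(* Let $P$ be a $(\mathbf 3+\mathbf 1)$-free poset on $[n]$ and let $\lambda$ be a two-column shape. Let $\mathrm{keyT}_P(\lambda)$ be the set of $P$-tableaux of shape $\lambda$ with no right-unbalanced ladders. Then $\mathrm{powT}_P(\lambda)=\mathrm{keyT}_P(\lambda)=\mathrm{strongT}_P(\lambda)$.
   Context: A poset is $(\mathbf 3+\mathbf 1)$-free if it has no induced subposet isomorphic to the disjoint union of a 3-element chain and a 1-element chain. Young diagrams are in English convention; a two-column shape is a partition whose diagram has two columns. A $P$-tableau of shape $\lambda$ is a filling $T:\lambda\to P$ with $T_{i,j}<_P T_{i+1,j}$ and $T_{i,j}\not>_P T_{i,j+1}$ (entries may repeat). For adjacent columns $C,D$, a ladder is a connected component of the subgraph of $\mathrm{inc}(P)$ (edges: distinct incomparable pairs) induced on the set $C\cup D$; it is right-unbalanced if it has more elements in the right column than in the left (an element in both columns counts in each). $\mathrm{strongT}_P(\lambda)$ is the set of $P$-tableaux of shape $\lambda$ such that no pair of adjacent columns has a right-unbalanced ladder. A word $w_1\cdots w_k$ in $P$ is a powersum word if $w_i\not>_P w_{i+1}$ for all $i<k$ and there is no $i<k$ with $w_i<_Pw_j$ for all $j>i$. For a composition $\alpha$ with positive parts, a powerful array of shape $\alpha$ is a filling $A$ of $\{(i,j):1\le j\le\alpha_i\}$ by elements of $P$ such that (1) each row is a powersum word; (2) $A_{r,t}<_PA_{s,t}$ whenever both cells exist and $r<s$; (3) $A_{r,\alpha_r}<_PA_{s,t}$ for all cells $(s,t)$ with $s>r$, $t>\alpha_r$.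 $\mathrm{tab}(A)$ is the filling of $\mathrm{sort}(\alpha)$ (parts in decreasing order) obtained by pushing the entries of each column upward until top-justified. $\mathrm{powT}_P(\lambda)$ is the set of $P$-tableaux of shape $\lambda$ of the form $\mathrm{tab}(A)$, $A$ a powerful array. *)

(* Defs.v *)
From HB Require Import structures.
From mathcomp Require Import all_boot all_order.

Set Implicit Arguments.
Unset Strict Implicit.
Unset Printing Implicit Defensive.

Import Order.TTheory.
Local Open Scope order_scope.

(* Throughout, rows, columns and positions are numbered from 0. *)

(* [x >< a] (incomparable) implies [x != a]. *)
Definition three_plus_one_free (d : Order.disp_t) (P : porderType d) : Prop :=
  forall a b c x : P, a < b -> b < c -> ~ [/\ x >< a, x >< b & x >< c].

Definition is_composition (alpha : seq nat) : bool :=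
  all (fun a => 0 < a)%N alpha.

Definition is_partition (lam : seq nat) : bool :=
  is_composition lam && sorted geq lam.

Definition two_column (lam : seq nat) : bool :=
  is_partition lam && (head 0%N lam == 2%N).

(* A filling of the left-justified diagram with row lengths [alpha] is the list
   of its rows, i.e. some [A : seq (seq T)] with [shape A = alpha]. *)

(* [None] when there is no cell in row [i] and column [j]. *)
Definition entry (T : Type) (A : seq (seq T)) (i j : nat) : option T :=
  onth (nth [::] A i) j.

(* Entries of column [j] from top to bottom; rows that do not reach column [j]
   are skipped. *)
Definition column (T : Type) (A : seq (seq T)) (j : nat) : seq T :=
  pmap (fun row => onth row j) A.

Definition columns (T : Type) (A : seq (seq T)) : seq (seq T) :=
  mkseq (column A) (\max_(row <- A) size row).

(* Once the columns are top-justified, row [i] consists of the [i]-th entries of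
   the columns that have one. When the row lengths of [A] are positive, the
   resulting shape is that of [A] sorted in decreasing order: column heights
   are weakly decreasing, and column 0 has height [size A]. *)
Definition tab (T : Type) (A : seq (seq T)) : seq (seq T) :=
  mkseq (fun i => pmap (fun C => onth C i) (columns A)) (size A).

Section PTableaux.
Variables (d : Order.disp_t) (P : finPOrderType d).
Implicit Types (T A : seq (seq P)) (lam alpha : seq nat) (C D L : {set P}).

Definition Ptableau lam T : Prop :=
  [/\ shape T = lam,
      forall i j x y, entry T i j = Some x -> entry T i.+1 j = Some y -> x < y
    & forall i j x y, entry T i j = Some x -> entry T i j.+1 = Some y ->
        ~~ (y < x)].

Definition inc_on (S : {set P}) : rel P :=
  [rel x y | [&& x \in S, y \in S & x >< y]].

Definition ladders C D : {set {set P}} :=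
  equivalence_partition (connect (inc_on (C :|: D))) (C :|: D).

Definition right_unbalanced C D L : bool := (#|L :&: C| < #|L :&: D|)%N.

Definition no_right_unbalanced_ladder C D : Prop :=
  forall L, L \in ladders C D -> ~~ right_unbalanced C D L.

Definition column_set T j : {set P} := [set x in column T j].

Definition strongT lam T : Prop :=
  Ptableau lam T /\
  forall j, (j.+1 < size (columns T))%N ->
    no_right_unbalanced_ladder (column_set T j) (column_set T j.+1).

(* Meant for two-column shapes only: the columns are 0 and 1. *)
Definition keyT lam T : Prop :=
  Ptableau lam T /\
  no_right_unbalanced_ladder (column_set T 0) (column_set T 1).

Definition powersum_word (w : seq P) : Prop :=
  sorted (fun x y => ~~ (y < x)) w /\
  forall i x, (i.+1 < size w)%N -> onth w i = Some x ->
    ~~ all (fun y => x < y) (drop i.+1 w).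

Definition powerful_array alpha A : Prop :=
  [/\ is_composition alpha /\ shape A = alpha,
      forall w, w \in A -> powersum_word w,
      forall r s t x y, (r < s)%N ->
        entry A r t = Some x -> entry A s t = Some y -> x < y
    & forall r s t x y, (r < s)%N -> (nth 0 alpha r <= t)%N ->
        entry A r (nth 0 alpha r).-1 = Some x -> entry A s t = Some y ->
        x < y].

Definition powT lam T : Prop :=
  Ptableau lam T /\ exists alpha A, powerful_array alpha A /\ T = tab A.

End PTableaux.

(* Main.v *)
Require Import Defs.
From mathcomp Require Import all_boot all_order.

Set Implicit Arguments.
Unset Strict Implicit.
Unset Printing Implicit Defensive.

Import Order.TTheory.

(** Let C and D be the two columns of a two-column tableau, and call two
    elements unordered when they are equal or incomparable.  A powersum word of
    length two is exactly a pair of unordered elements, so a powerful array with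
    columns C and D is an increasing partial matching between the chains C and D
    that pairs each e in D with some c in C unordered to e, subject to one more
    condition: an unmatched element of C lies below every element of D that
    occurs in a later row.

    Given such an array, the two entries of a row of length two lie in the same
    ladder, so matching embeds the right part of every ladder into its left part
    ([powerful_rows_balanced]).

    Conversely, suppose no ladder is right-unbalanced, and build the array
    greedily.  Scan C upwards, keeping the first unmatched e in D: the scanned c
    becomes the row c e if c and e are unordered, and the row c alone if c < e
    or if D is exhausted.  The extra condition then holds by construction.  The
    scan is stuck only when the next c exceeds e, or when C is exhausted before
    D.  In that case, look at the block of pairs formed since the last single
    row.  (3+1)-freeness says that an element unordered to both ends of a chain
    a < b < c cannot exist ([no_unordered_span]); it implies that the block
    together with e is a union of ladders ([stuck_scan]).  In the ladder of e,
    the left elements are all matched, within that ladder, while e is an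
    unmatched right element: the ladder is right-unbalanced, a contradiction.
    So the scan succeeds ([scan_complete]).

    Finally, top-justifying a filling does not change its columns, and a filling
    of a partition shape is determined by its columns ([column_tab], [tab_id],
    [eq_tab]); this translates statements about C and D into statements about
    tableaux and arrays.  With two columns there is a single pair of adjacent
    columns, hence the equality with the third set. *)

(** * Columns of fillings and top-justification *)

Section Columns.
Variable T : Type.
Implicit Types (A B : seq (seq T)) (s : seq T).

Lemma pmap_map (U V : Type) (f : U -> option T) (g : V -> U) (r : seq V) :
  pmap f (map g r) = pmap (f \o g) r.
Proof. by elim: r => //= x r ->. Qed.

Lemma pmap_onth_iota s n : size s <= n -> pmap (onth s) (iota 0 n) = s.
Proof.
elim: s n => [|x s IHs] n; last first.
  case: n => [|n] //= lesn.
  by congr cons; rewrite (iotaDl 1 0) pmap_map; apply: IHs.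
by elim: (iota 0 n) => // i r IHr; rewrite /= IHr; case: i.
Qed.

Lemma size_column A j : size (column A j) = count (fun r => j < size r) A.
Proof. by rewrite size_pmap; apply: eq_count => r /=; rewrite onthTE. Qed.

Lemma size_column0 A : is_composition (shape A) -> size (column A 0) = size A.
Proof.
by rewrite size_column /is_composition all_map all_count => /eqP.
Qed.

Lemma max_size_leq A j :
  (\max_(row <- A) size row <= j) = nilp (column A j).
Proof.
rewrite /nilp size_column eqn0Ngt -has_count.
elim: A => [|r A IHA] /=; first by rewrite big_nil.
by rewrite big_cons geq_max IHA negb_or -leqNgt.
Qed.

Lemma column_nil A j : \max_(row <- A) size row <= j -> column A j = [::].
Proof. by rewrite max_size_leq => /nilP. Qed.

(** In a partition shape a row that misses column [j] is followed only by such
    rows, so that nothing is skipped before the [i]-th entry of the column. *)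
Lemma onth_column A i j :
  sorted geq (shape A) -> onth (column A j) i = entry A i j.
Proof.
elim: A i => [|r A IHA] i; first by rewrite /entry !onth0n nth_nil onth0n.
rewrite [sorted _ _]/= (path_sortedE (rev_trans leq_trans)) => /andP[ler sA].
have [ltjr|lerj] := ltnP j (size r).
  have := onthTE r j; rewrite ltjr; case def_rj: (onth r j) => [x|] // _.
  have -> : column (r :: A) j = x :: column A j by rewrite /column /= def_rj.
  by case: i => [|i]; [rewrite /entry /= def_rj | apply: IHA].
have maxA : \max_(row <- A) size row <= j.
  elim: A ler {IHA sA} => [|s A IHA] /=; first by rewrite big_nil.
  by case/andP=> /leq_trans les /IHA; rewrite big_cons geq_max les.
rewrite column_nil ?big_cons ?geq_max ?lerj // onth0n.
case: i => [|i]; first by rewrite /entry /= onth_default.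
by rewrite -[RHS]/(entry A i j) -IHA // column_nil ?onth0n.
Qed.

(** Equal columns force equal widths: by [max_size_leq] the number of columns is
    the index of the first empty one. *)
Lemma eq_columns A B :
  (forall j, column A j = column B j) -> columns A = columns B.
Proof.
move=> eqAB; rewrite /columns.
have -> : \max_(row <- A) size row = \max_(row <- B) size row.
  apply/eqP; rewrite eqn_leq !max_size_leq eqAB -max_size_leq leqnn.
  by rewrite -eqAB -max_size_leq leqnn.
exact: eq_map.
Qed.

Lemma entry_columns A i j : entry (columns A) j i = onth (column A j) i.
Proof.
have [ltj|gej] := ltnP j (\max_(row <- A) size row).
  by rewrite /entry nth_mkseq.
by rewrite /entry nth_default ?size_mkseq // (column_nil gej).
Qed.

Lemma sorted_columns A : sorted geq (shape (columns A)).
Proof.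
apply/(sortedP 0) => i; rewrite size_map size_mkseq => lti.
rewrite !(nth_map [::]) ?size_mkseq ?(ltnW lti) // !nth_mkseq ?(ltnW lti) //.
by rewrite /= !size_column; apply: sub_count => r /ltnW.
Qed.

(** [tab A] lists the columns of [columns A], and [columns A], whose row lengths
    decrease, is a filling of a partition shape.  So this is [onth_column] for
    the transposed filling. *)
Lemma column_tab A j : column (tab A) j = column A j.
Proof.
rewrite -[RHS](@pmap_onth_iota _ (size A)) ?size_column ?count_size //.
rewrite /tab {1}/column pmap_map; apply: eq_pmap => i /=.
by rewrite -/(column (columns A) i) onth_column ?sorted_columns ?entry_columns.
Qed.

Lemma tab_id A : sorted geq (shape A) -> tab A = A.
Proof.
move=> sA; apply: (@eq_from_nth _ [::]) => [|i]; rewrite size_mkseq // => ltiA.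
rewrite nth_mkseq // pmap_map /comp /=.
rewrite -[RHS](@pmap_onth_iota _ (\max_(row <- A) size row)).
  by apply: eq_pmap => j; rewrite onth_column.
by rewrite (big_nth [::]) big_mkord (leq_bigmax (Ordinal ltiA)).
Qed.

Lemma eq_tab A B : size A = size B ->
  (forall j, column A j = column B j) -> tab A = tab B.
Proof. by rewrite /tab => -> /eq_columns->. Qed.

End Columns.

Lemma sorted_lt_entry d (P : porderType d) (A : seq (seq P)) j :
  sorted <%O (column A j) ->
  forall r s x y, r < s ->
    entry A r j = Some x -> entry A s j = Some y -> (x < y)%O.
Proof.
elim: A => [|row A IHA] sA r s x y; first by rewrite /entry nth_nil onth0n.
case: r s => [|r] [|s] //=; rewrite ?ltnS.
  rewrite /entry /= => _ def_x def_y; move: sA.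
  rewrite /column /= def_x /= -/(column A j) (path_sortedE lt_trans).
  case/andP=> /allP ltx _; apply: ltx; rewrite mem_pmap; apply/mapP.
  have ltsA : s < size A.
    rewrite ltnNge; apply/negP=> /(nth_default [::]) As.
    by rewrite As onth0n in def_y.
  by exists (nth [::] A s); rewrite ?mem_nth.
apply: IHA; move: sA; rewrite /column /=; case: (onth row j) => //= z.
exact: path_sorted.
Qed.

Lemma sorted_lt_column d (P : porderType d) (T : seq (seq P)) j :
  sorted geq (shape T) ->
  (forall i x y,
    entry T i j = Some x -> entry T i.+1 j = Some y -> (x < y)%O) ->
  sorted <%O (column T j).
Proof.
move=> sT ltT; case def_col: (column T j) => [|x0 s] //; rewrite -def_col.
apply/(sortedP x0) => i lti; apply: (ltT i); rewrite -onth_column //.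
  have := onthTE (column T j) i; rewrite (ltnW lti).
  by case E: onth => [y|] // _; rewrite (onth_nth x0 y _ _ E).
have := onthTE (column T j) i.+1; rewrite lti.
by case E: onth => [y|] // _; rewrite (onth_nth x0 y _ _ E).
Qed.

(** * Unordered pairs and ladders *)

Section Ladders.
Variables (d : Order.disp_t) (P : finPOrderType d).
Implicit Types (x y a b c : P) (s C D Cb Db : seq P) (L S : {set P}).

Local Open Scope order_scope.

Definition unordered x y := ~~ (x < y) && ~~ (y < x).

Lemma unordered_sym x y : unordered x y = unordered y x.
Proof. by rewrite /unordered andbC. Qed.

Lemma unorderedE x y : unordered x y = (x == y) || (x >< y).
Proof. by rewrite /unordered; case: (comparableP x y). Qed.

Lemma unordered_chain x y s : sorted <%O s -> x \in s -> y \in s ->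
  unordered x y -> x = y.
Proof.
rewrite lt_sorted_pairwise => /(pairwiseP x) ss /(nthP x)[i lti <-].
case/(nthP x)=> j ltj <-; rewrite /unordered.
case: (ltngtP i j) => [ltij|ltji|->//].
  by rewrite ss.
by rewrite (ss j i) ?andbF.
Qed.

(** The form in which (3+1)-freeness is used: [x] cannot equal [a] or [c],
    since these are comparable, and it is then incomparable to [b] too. *)
Lemma no_unordered_span x a b c : three_plus_one_free P ->
  a < b -> b < c -> unordered x a -> unordered x c -> False.
Proof.
move=> hP ab bc; have ac := lt_trans ab bc.
rewrite !unorderedE => /orP[/eqP->|xa] /orP[/eqP xc|xc].
- by rewrite xc ltxx in ac.
- by rewrite incomparable_ltF in ac.
- by rewrite xc comparable_sym lt_comparable in xa.
apply: (hP a b c x ab bc); split=> //.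
apply/negP=> /orP[/le_lt_trans/(_ bc) ltxc | /(lt_le_trans ab) ltax].
  by rewrite incomparable_ltF in ltxc.
by rewrite comparable_sym lt_comparable in xa.
Qed.

Lemma inc_on_sym S : symmetric (inc_on S).
Proof. by move=> x y; rewrite /inc_on /= comparable_sym andbCA. Qed.

Lemma ladder_unordered (X Y : {set P}) L x y : L \in ladders X Y ->
  x \in X :|: Y -> y \in X :|: Y -> unordered x y -> (x \in L) = (y \in L).
Proof.
move=> /imsetP[z _ ->] xXY yXY; rewrite unorderedE => /orP[/eqP->//|xy].
have con_xy : connect (inc_on (X :|: Y)) x y.
  by apply: connect1; apply/and3P.
rewrite in_set [in RHS]in_set xXY yXY /=.
by rewrite (same_connect_r (sym_connect_sym (@inc_on_sym _)) con_xy).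
Qed.

Lemma card_ladder_column L s :
  uniq s -> #|L :&: [set x in s]| = count (mem L) s.
Proof.
move=> us; rewrite -size_filter -(card_uniqP (filter_uniq _ us)).
by apply: eq_card => x; rewrite !inE mem_filter.
Qed.

Lemma no_right_unbalanced_count C D : uniq C -> uniq D ->
  (forall L, L \in ladders [set x in C] [set x in D] ->
    (count (mem L) D <= count (mem L) C)%N) <->
  no_right_unbalanced_ladder [set x in C] [set x in D].
Proof.
move=> uC uD; rewrite /no_right_unbalanced_ladder /right_unbalanced.
by split=> le_DC L /le_DC; rewrite !card_ladder_column // -leqNgt.
Qed.

(** Paired elements lie in the same ladder by [ladder_unordered]. *)
Lemma count_pairing C D Cb Db L : L \in ladders [set x in C] [set x in D] ->
  {subset Cb <= C} -> {subset Db <= D} -> all2 unordered Cb Db ->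
  count (mem L) Cb = count (mem L) Db.
Proof.
move=> lL; elim: Cb Db => [|c Cb IH] [|e Db] //= sC sD /andP[uce uCD].
rewrite (IH Db) //; last 2 first.
- by move=> x xC; apply: sC; rewrite inE xC orbT.
- by move=> x xC; apply: sD; rewrite inE xC orbT.
congr (_ + _)%N; congr nat_of_bool.
by apply: (ladder_unordered lL _ _ uce);
  rewrite !inE ?(sC _ (mem_head _ _)) ?(sD _ (mem_head _ _)) ?orbT.
Qed.

Lemma mem_pairedl Cb Db x : all2 unordered Cb Db -> x \in Cb ->
  exists2 y, y \in Db & unordered x y.
Proof.
elim: Cb Db => [|c Cb IH] [|e Db] //= /andP[uce uCD]; rewrite inE.
case/orP=> [/eqP->|/(IH _ uCD)[y yDb uxy]]; first by exists e; rewrite ?mem_head.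
by exists y; rewrite // inE yDb orbT.
Qed.

Lemma all2_unorderedC Cb Db : all2 unordered Cb Db = all2 unordered Db Cb.
Proof. by elim: Cb Db => [|c C IH] [|e D] //=; rewrite IH unordered_sym. Qed.

Lemma mem_pairedr Cb Db y : all2 unordered Cb Db -> y \in Db ->
  exists2 x, x \in Cb & unordered x y.
Proof.
rewrite all2_unorderedC => uDC /(mem_pairedl uDC)[x xC]; exists x => //.
by rewrite unordered_sym.
Qed.

(** * The greedy scan *)

(** The invariant of the scan.  The unread parts of the two columns are [C2] and
    [D2]; [Cb] and [Db] are the pairs formed since the last single row, and [C0]
    and [D0] are what was read up to and including that row.  The last two
    conditions say that no ladder edge joins [C0] to [Db ++ D2], or [D0] to
    [Cb ++ C2]. *)
Definition scan_state C0 Cb C2 D0 Db D2 :=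
  [/\ sorted <%O (C0 ++ Cb ++ C2), sorted <%O (D0 ++ Db ++ D2),
      all2 unordered Cb Db, allrel <%O C0 (Db ++ D2)
    & allrel <%O D0 (Cb ++ C2)].

(** The set [S] of the current block and [e] is closed under incomparability.
    Downwards and towards [C2] the order relations at hand exclude an edge
    leaving [S]; an edge from [x] in [Cb] to [y] in [D2] is excluded because [x]
    would be unordered to both ends of the chain formed by its partner, [e] and
    [y].  So the ladder [L] of [e] meets the left column inside [Cb], and its
    right part contains the partners of these elements and also [e]. *)
Lemma stuck_scan C0 Cb C2 D0 Db e D2 : three_plus_one_free P ->
  scan_state C0 Cb C2 D0 Db (e :: D2) -> all (> e) C2 ->
  ~ no_right_unbalanced_ladder [set x in C0 ++ Cb ++ C2]
                               [set x in D0 ++ Db ++ e :: D2].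
Proof.
move=> hP [sC sD uCD lt0 lt0'] lteC.
move/(no_right_unbalanced_count (lt_sorted_uniq sC) (lt_sorted_uniq sD)).
set C := C0 ++ _ in sC *; set D := D0 ++ _ in sD *.
set X := [set x in C]; set Y := [set x in D] => balanced.
have eD : e \in D by rewrite !mem_cat mem_head !orbT.
have sCb : {subset Cb <= C} by move=> x xC; rewrite !mem_cat xC orbT.
have sDb : {subset Db <= D} by move=> x xC; rewrite !mem_cat xC orbT.
pose S := [pred x | (x \in Cb) || (x \in rcons Db e)].
pose L := [set y in X :|: Y | connect (inc_on (X :|: Y)) e y].
have lL : L \in ladders X Y by apply: imset_f; rewrite !inE eD orbT.
have := sD; rewrite lt_sorted_pairwise !pairwise_cat /= => /and3P[_ _].
case/and4P=> ltDb _ ltD2 _.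
move: ltDb; rewrite allrel_consr => /andP[/allP ltDe /allrelP ltDb2].
have {}lteC c : c \in C2 -> e < c by move/allP: lteC; apply.
have {}ltD2 y : y \in D2 -> e < y by move/allP: ltD2; apply.
have lt0S c y : c \in C0 -> y \in rcons Db e -> c < y.
  move=> cC; rewrite mem_rcons inE => yD; apply: (allrelP lt0) => //.
  by rewrite mem_cat inE; case/orP: yD => ->; rewrite ?orbT.
have lt0S' y c : y \in D0 -> c \in Cb -> y < c.
  by move=> yD cC; apply: (allrelP lt0') => //; rewrite mem_cat cC.
have ltS2 y c : y \in rcons Db e -> c \in C2 -> y < c.
  rewrite mem_rcons inE => /predU1P[->|/ltDe ltye] /lteC //.
  exact: lt_trans.
(* An incomparable pair joins the two columns, since each is a chain. *)
have closedS : closed (inc_on (X :|: Y)) S.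
  apply: (intro_closed (sym_connect_sym (@inc_on_sym _))) => x y.
  case/and3P; rewrite !inE => xCD yCD xy /orP[xCb|xDb].
    have [yC|] := boolP (y \in C).
      have eq_xy: x = y.
        by apply: unordered_chain sC (sCb _ xCb) yC _; rewrite unorderedE xy orbT.
      by rewrite -eq_xy xCb.
    move=> yC; move: yCD; rewrite (negPf yC) /= !mem_cat mem_rcons !inE.
    case/or4P=> [yD0|->|->|yD2]; rewrite ?orbT //.
      by move: xy; rewrite comparable_sym lt_comparable ?lt0S'.
    have [z zDb uxz] := mem_pairedl uCD xCb.
    case: (no_unordered_span hP (ltDe _ zDb) (ltD2 _ yD2) uxz).
    by rewrite unorderedE xy orbT.
  have xD : x \in D.
    by move: xDb; rewrite mem_rcons inE => /predU1P[->|/sDb].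
  have [yD|yD] := boolP (y \in D).
    have eq_xy: x = y.
      by apply: unordered_chain sD xD yD _; rewrite unorderedE xy orbT.
    by rewrite -eq_xy xDb orbT.
  move: yCD; rewrite (negPf yD) orbF !mem_cat => /or3P[yC0|->|yC2] //.
    by move: xy; rewrite comparable_sym lt_comparable ?lt0S.
  by move: xy; rewrite lt_comparable ?ltS2.
have LS x : x \in L -> (x \in Cb) || (x \in rcons Db e).
  rewrite inE -[_ || _]/(x \in S) => /andP[_ /(closed_connect closedS) <-].
  by rewrite inE mem_rcons mem_head orbT.
(* An element of [C0] or [C2] cannot sneak into [S] as an element of [Db] or
   as [e]: it would be smaller than itself. *)
have countC0 : count (mem L) C0 = 0.
  apply/eqP; rewrite -leqn0 leqNgt -has_count; apply/hasPn => x xC0.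
  apply/negP=> /LS /orP[xCb|xDb]; last by have := lt0S x x xC0 xDb; rewrite ltxx.
  move: sC; rewrite lt_sorted_pairwise pairwise_cat => /andP[/allrelP].
  by move/(_ x x xC0); rewrite mem_cat xCb ltxx => /(_ isT).
have countC2 : count (mem L) C2 = 0.
  apply/eqP; rewrite -leqn0 leqNgt -has_count; apply/hasPn => x xC2.
  apply/negP=> /LS /orP[xCb|xDb]; last by have := ltS2 x x xDb xC2; rewrite ltxx.
  move: sC; rewrite lt_sorted_pairwise !pairwise_cat => /and4P[_ _ /allrelP].
  by move/(_ x x xCb xC2); rewrite ltxx.
have := balanced L lL.
rewrite !count_cat countC0 countC2 addn0 add0n (count_pairing lL sCb sDb uCD) /=.
have -> : e \in L by rewrite !inE eD orbT connect0.
by rewrite addnCA -[X in (_ <= X)%N]addn0 leq_add2l addnCA.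
Qed.


Definition paired_row (r : seq P) :=
  match r with
  | [:: _] => true
  | [:: c; e] => unordered c e
  | _ => false
  end.

(** Restricted to rows of length one or two, the third defining condition of
    powerful arrays is [pairwise precedes_right]. *)
Definition precedes_right (r s : seq P) :=
  if (r, s) is ([:: c], [:: _; e]) then c < e else true.

Lemma scan_pair C0 Cb c C2 D0 Db e D2 : unordered c e ->
  scan_state C0 Cb (c :: C2) D0 Db (e :: D2) ->
  scan_state C0 (rcons Cb c) C2 D0 (rcons Db e) D2.
Proof.
move=> uce [sC sD uCD lt0 lt0']; split; rewrite ?cat_rcons //.
elim: Cb Db uCD {sC sD lt0 lt0'} => [|x Cb IH] [|y Db] //=; first by rewrite uce.
by case/andP=> -> /IH.
Qed.

(** A single row closes the block.  That the elements of [Db] lie below [C2] is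
    where (3+1)-freeness enters: otherwise some [y] in [Db] would be unordered
    to both ends of the chain [x < c < z], with [x] the partner of [y] and [z]
    in [C2]. *)
Lemma scan_single C0 Cb c C2 D0 Db D2 : three_plus_one_free P ->
  all (> c) D2 ->
  scan_state C0 Cb (c :: C2) D0 Db D2 ->
  scan_state (C0 ++ rcons Cb c) [::] C2 (D0 ++ Db) [::] D2.
Proof.
move=> hP ltcD [sC sD uCD lt0 lt0']; split=> //.
- by rewrite -catA cat_rcons.
- by rewrite -catA.
- move: lt0; rewrite /= !allrel_catl allrel_catr => /andP[_ ->] /=.
  rewrite -cats1 allrel_catl allrel1l ltcD andbT.
  apply/allrelP => x y xCb yD2; apply: lt_trans (allP ltcD _ yD2).
  move: sC; rewrite lt_sorted_pairwise !pairwise_cat => /and4P[_ _ /allrelP ltC _].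
  by apply: ltC; rewrite ?mem_head.
rewrite allrel_catl; apply/andP; split.
  by move: lt0'; rewrite /= -cat_rcons allrel_catr => /andP[].
apply/allrelP => y z yDb zC2.
have [x xCb uxy] := mem_pairedr uCD yDb.
move: sC; rewrite lt_sorted_pairwise !pairwise_cat allrel_consr /=.
case/and4P=> _ _ /andP[/allP ltCbc _] /andP[_ /andP[/allP ltc _]].
have [ltxc ltcz] := (ltCbc x xCb, ltc z zC2).
rewrite unordered_sym in uxy.
case: (boolP (y < z)) => // nltyz.
case: (no_unordered_span hP ltxc ltcz uxy); rewrite /unordered nltyz /=.
apply: contraL uxy => /(lt_trans (lt_trans ltxc ltcz)) ltxy.
by rewrite /unordered ltxy andbF.
Qed.

Lemma sorted_lt_tail s1 s2 x s3 :
  sorted <%O (s1 ++ s2 ++ x :: s3) -> all (> x) s3.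
Proof.
by rewrite lt_sorted_pairwise !pairwise_cat => /and5P[_ _ _ _ /andP[]].
Qed.

(** Only a stuck position could prevent the scan from ending with both columns
    read, and [stuck_scan] excludes it. *)
Lemma scan_complete C D : three_plus_one_free P ->
  no_right_unbalanced_ladder [set x in C] [set x in D] ->
  forall C2 C0 Cb D0 Db D2, C = C0 ++ Cb ++ C2 -> D = D0 ++ Db ++ D2 ->
  scan_state C0 Cb C2 D0 Db D2 ->
  exists A, [/\ all paired_row A, pairwise precedes_right A,
                column A 0 = C2 & column A 1 = D2].
Proof.
move=> hP balanced; elim=> [|c C2 IH] C0 Cb D0 Db D2 defC defD st.
  case: D2 => [|e D2] in defD st *; first by exists [::].
  by case: (stuck_scan hP st isT); rewrite -defC -defD.
have [ltcD|] := boolP (all (> c) D2).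
  have [||A [okA prA colA0 colA1]] := IH _ _ _ _ _ _ _ (scan_single hP ltcD st).
  - by rewrite -catA cat_rcons.
  - by rewrite -catA.
  exists ([:: c] :: A); split; rewrite /column //=.
  - rewrite prA andbT; move: ltcD okA; rewrite -colA1.
    elim: A {prA colA0 colA1} => //= r A IHA.
    case: r => [|x [|y [|]]] //=; rewrite /column /=.
    by case/andP=> ltcy ltcA /andP[_ okA]; rewrite (IHA ltcA okA) andbT.
  - by rewrite -/(column A 0) colA0.
case: D2 => [|e D2] // in defD st * => nltcD.
have [sC sD _ _ _] := st.
have nltce : ~~ (c < e).
  apply: contra nltcD => ltce /=; rewrite ltce.
  by apply: sub_all (sorted_lt_tail sD) => y; apply: lt_trans.
have [ltec|nltec] := boolP (e < c).
  case: (stuck_scan hP st _); rewrite -?defC -?defD //= ltec.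
  by apply: sub_all (sorted_lt_tail sC) => y; apply: lt_trans.
have uce : unordered c e by rewrite /unordered nltce.
have [||A [okA prA colA0 colA1]] := IH _ _ _ _ _ _ _ (scan_pair uce st).
- by rewrite cat_rcons.
- by rewrite cat_rcons.
exists ([:: c; e] :: A); split; rewrite /column /=.
- by rewrite uce.
- by rewrite prA andbT; apply/allP => s _.
- by rewrite -/(column A 0) colA0.
- by rewrite -/(column A 1) colA1.
Qed.

(** * Powerful arrays with at most two columns *)

Lemma paired_rows_powerful A :
  all paired_row A -> pairwise precedes_right A ->
  sorted <%O (column A 0) -> sorted <%O (column A 1) ->
  powerful_array (shape A) A.
Proof.
move=> /allP okA prA s0 s1; split.
- by split=> //; rewrite /is_composition all_map; apply/allP => r /okA; case: r.
- move=> w /okA; case: w => [|c [|e [|]]] //.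
  case/andP=> nltce nltec; split=> /=; first by rewrite nltec.
  by case=> [|[|]] // x _ [<-]; rewrite /= andbT.
- move=> r s [|[|t]] x y ltrs; try exact: sorted_lt_entry ltrs.
  have [ltrA|leAr] := ltnP r (size A); last first.
    by rewrite /entry nth_default ?onth0n.
  have := okA _ (mem_nth [::] ltrA); rewrite /entry.
  by case: nth => [|? [|? []]] //=; rewrite !onth0n.
move=> r s t x y ltrs; have [ltrA|leAr] := ltnP r (size A); last first.
  by rewrite /entry (nth_default _ leAr) onth0n.
have [ltsA|leAs] := ltnP s (size A); last first.
  by rewrite /entry (nth_default _ leAs) onth0n.
have := pairwiseP [::] prA r s; rewrite !inE => /(_ ltrA ltsA ltrs).
rewrite (nth_map [::]) // /entry.
have := okA _ (mem_nth [::] ltsA); have := okA _ (mem_nth [::] ltrA).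
case: (nth _ _ r) => [|c [|e []]] //; case: (nth _ _ s) => [|f [|g []]] //=;
  by case: t => [|[|[|]]] //= _ _ lt_cg _ [<-] [<-].
Qed.

Lemma mem_column_behead r A j x : x \in column A j -> x \in column (r :: A) j.
Proof. by rewrite !mem_pmap inE orbC => ->. Qed.

(** In a row of length two, the powersum condition at the first letter denies
    [x < y] and the descent condition denies [y < x]; so both entries are in
    [L] or neither is, and rows of length one only help the left column. *)
Lemma powerful_rows_balanced alpha A L (X Y : {set P}) :
  powerful_array alpha A -> column A 2 = [::] ->
  L \in ladders X Y -> {subset column A 0 <= X} -> {subset column A 1 <= Y} ->
  (count (mem L) (column A 1) <= count (mem L) (column A 0))%N.
Proof.
case=> _ + _ _ + lL; elim: A => //= r A IHA powA col2 sX sY.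
have le_tl : (size r <= 2)%N ->
    (count (mem L) (column A 1) <= count (mem L) (column A 0))%N.
  move=> le_r2; apply: IHA.
  - by move=> w Aw; apply: powA; rewrite inE Aw orbT.
  - by move: le_r2 col2; case: (r) => [|? [|? []]].
  - by move=> x xA; apply: sX; apply: mem_column_behead.
  - by move=> x xA; apply: sY; apply: mem_column_behead.
case: r => [|x [|y [|z r]]] in powA col2 sX sY le_tl *; rewrite /column //=.
- exact: le_tl.
- by rewrite -!/(column A _) (leq_trans (le_tl isT)) ?leq_addl.
rewrite -!/(column A _) leq_add ?le_tl //.
have [/= /andP[nltyx _] /(_ 0 x isT erefl)] := powA _ (mem_head _ _).
rewrite /= andbT => nltxy.
rewrite (ladder_unordered lL _ _ (_ : unordered x y)) // ?inE.
- by rewrite sX // /column /= mem_head.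
- by rewrite (sY y) ?orbT // /column /= mem_head.
by rewrite /unordered nltxy.
Qed.

End Ladders.

Theorem lemma3p12 (d : Order.disp_t) (P : finPOrderType d) (lam : seq nat)
    (hP : three_plus_one_free P) (hlam : two_column lam) :
  (forall T : seq (seq P), powT lam T <-> keyT lam T) /\
  (forall T : seq (seq P), keyT lam T <-> strongT lam T).
Proof.
case/andP: hlam => /andP[lam_gt0 lam_sorted] /eqP lam2.
have widthT T : Ptableau lam T -> \max_(row <- T) size row = 2.
  case=> shT _ _; have -> : \max_(row <- T) size row = \max_(n <- lam) n.
    by rewrite -shT /shape big_map.
  case: lam lam2 lam_sorted {lam_gt0 shT} => //= _ s ->.
  rewrite (path_sortedE (rev_trans leq_trans)) => /andP[/allP le2 _].
  rewrite big_cons; apply/maxn_idPl/bigmax_leqP_seq => n sn _; exact: le2.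
have sortedT T : Ptableau lam T -> forall j, sorted <%O (column T j).
  case=> shT ltT _ j; apply: sorted_lt_column; rewrite ?shT // => i x y.
  exact: ltT.
split=> T; last first.
  split=> -[tabT bal]; split=> //.
    by case=> [|j]; rewrite size_mkseq widthT.
  by apply: bal; rewrite size_mkseq widthT.
split=> -[tabT].
  case=> alpha [A [powA defT]]; split=> //.
  apply/no_right_unbalanced_count=> [||L lL]; try exact/lt_sorted_uniq/sortedT.
  have colT j : column T j = column A j by rewrite defT column_tab.
  rewrite !colT; apply: (powerful_rows_balanced powA _ lL) => [|x|x].
  - by rewrite -colT column_nil ?widthT.
  - by rewrite -colT inE.
  - by rewrite -colT inE.
move=> bal; split=> //.
have st : scan_state [::] [::] (column T 0) [::] [::] (column T 1).
  by split; rewrite //= sortedT.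
have [||A [okA prA colA0 colA1]] := scan_complete hP bal _ _ st; try by [].
exists (shape A), A; split.
  by apply: paired_rows_powerful; rewrite // ?colA0 ?colA1 sortedT.
have shT : sorted geq (shape T) by case: tabT => ->.
(* Columns 0 and 1 agree by construction, and all later ones are empty. *)
rewrite -[LHS](tab_id shT); apply: eq_tab => [|[|[|j]]] //.
- have sizeA : size (column A 0) = size A.
    apply: size_column0; rewrite /is_composition all_map.
    by apply: sub_all okA => -[].
  have sizeT : size (column T 0) = size T.
    by apply: size_column0; case: tabT => ->.
  by rewrite -sizeA -sizeT colA0.
rewrite (column_nil (A := T)) ?widthT // column_nil //.
apply/bigmax_leqP_seq => r Ar _.
by have := allP okA r Ar; case: r {Ar} => [|? [|? []]].
Qed.
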